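(* Fix $\beta>0$, $\gamma\in(0,1)$ and $\delta>0$. Then $$\limsup_{N\to\infty}\ \sup_{x\in\mathsf V_N}\ \mathbf P\big(d(x,\mathsf T(\delta))\le 2N/r_N\big)=0.$$
   Context: Constants: $g=2/\pi$, $\alpha=\sqrt{2\pi}$. For $N\ge3$, $\mathsf V_N=(-N,N)^2\cap\mathbb Z^2$, and $h=(h_x)_{x\in\mathsf V_N}$ is the DGFF: the centered Gaussian field with $\mathrm{Cov}(h_x,h_y)=\mathbf E_x\sum_{n=0}^{\tau-1}\mathbf 1_{\{S_n=y\}}$, $(S_n)$ discrete-time simple random walk on $\mathbb Z^2$ started at $x$ and $\tau$ its exit time from $\mathsf V_N$. Set $\tau_x=e^{\beta h_x}$, $\widehat t_N=N^{2\sqrt g\beta}(\log N)^{-\frac{3+2\gamma}{2\alpha}\beta}$, $\widehat\tau_x=\tau_x/\widehat t_N$, $r_N=\exp\{(\log\log N)^{100(2+\gamma)}\}$, and $\mathsf T(\delta)=\{x\in\mathsf V_N:\widehat\tau_x\ge\delta\}$. $d$ is the sup-norm distance, with $d(x,\emptyset)=\infty$. *)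

(* Defs.v *)
From HB Require Import structures.
From mathcomp Require Import all_boot all_order all_algebra.
From mathcomp Require Import all_classical all_reals all_analysis.

Set Implicit Arguments.
Unset Strict Implicit.
Unset Printing Implicit Defensive.

Import Order.TTheory GRing.Theory Num.Theory.
Import numFieldNormedType.Exports.

Local Open Scope classical_set_scope.
Local Open Scope ring_scope.

Definition Z2 : Type := (int * int)%type.

(* V N = (-N, N)^2 /\ Z^2 *)
Definition V (N : nat) : set Z2 :=
  [set x | (- N%:Z < x.1 < N%:Z) /\ (- N%:Z < x.2 < N%:Z)].

Section random_walk.
Context {R : realType}.

(* Transition probability of simple random walk on Z^2. *)
Definition srw_step (u v : Z2) : R :=
  if `|u.1 - v.1| + `|u.2 - v.2| == 1 then 4^-1 else 0.

(* Under Px x, the process S is simple random walk started at x: this is the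
   Markov-chain description by the finite-dimensional laws of the trajectory. *)
Definition is_srw d (W : measurableType d) (Px : Z2 -> probability W R)
    (S : nat -> W -> Z2) : Prop :=
  (forall n y, measurable [set w | S n w = y]) /\
  (forall x n (p : nat -> Z2),
     Px x [set w | forall i, (i <= n)%N -> S i w = p i] =
     ((p 0%N == x)%:R * \prod_(i < n) srw_step (p i) (p i.+1))%:E).

(* Equals +oo when the trajectory s never leaves D. *)
Definition exit_time (D : set Z2) (s : nat -> Z2) : \bar R :=
  ereal_inf [set n%:R%:E | n in [set n | ~ D (s n)]].

(* E_x [ sum_{n = 0}^{tau - 1} 1_{S_n = y} ] *)
Definition green d (W : measurableType d) (Px : Z2 -> probability W R)
    (S : nat -> W -> Z2) (D : set Z2) (x y : Z2) : \bar R :=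
  (\int[Px x]_w
    \sum_(n <oo | (n%:R%:E < exit_time D (S ^~ w))%E) ((S n w == y)%:R)%:E)%E.

End random_walk.

Section gaussian_field.
Context {R : realType}.

(* Law N(m, s^2); the case s = 0 (the Dirac mass) has to be treated apart
   because normal_prob m 0 is by convention a uniform law. *)
Definition gaussian_law (m s : R) (A : set R) : \bar R :=
  if s == 0 then \d_m A else normal_prob m s A.

Definition is_gaussian d (T : measurableType d) (P : probability T R)
    (X : T -> R) : Prop :=
  measurable_fun setT X /\
  exists m s : R, forall A : set R, measurable A ->
    P (X @^-1` A) = gaussian_law m s A.

(* (h x)_{x in D}, D finite, is jointly Gaussian: every linear combination
   is Gaussian. The values of h outside D are irrelevant. *)
Definition is_gaussian_field d (T : measurableType d) (P : probability T R)
    (D : set Z2) (h : Z2 -> T -> R) : Prop :=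
  forall a : Z2 -> R, is_gaussian P (fun w => \sum_(x \in D) a x * h x w).

Definition is_dgff d (T : measurableType d) (P : probability T R)
    dW (W : measurableType dW) (Px : Z2 -> probability W R) (S : nat -> W -> Z2)
    (N : nat) (h : Z2 -> T -> R) : Prop :=
  [/\ forall x, V N x -> measurable_fun setT (h x),
      is_gaussian_field P (V N) h,
      forall x, V N x -> 'E_P[h x]%E = 0%E &
      forall x y, V N x -> V N y ->
        covariance P (h x) (h y) = green Px S (V N) x y].

End gaussian_field.

Section trap_model.
Context {R : realType}.

Definition g : R := 2 / pi.
Definition alpha : R := Num.sqrt (2 * pi).

Definition t_hat (beta gamma : R) (N : nat) : R :=
  N%:R `^ (2 * Num.sqrt g * beta) *
  ln N%:R `^ (- ((3 + 2 * gamma) / (2 * alpha) * beta)).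

Definition r_ (gamma : R) (N : nat) : R :=
  expR (ln (ln N%:R) `^ (100 * (2 + gamma))).

(* The argument f is a realisation of the field h. *)
Definition tau (beta : R) (f : Z2 -> R) (x : Z2) : R := expR (beta * f x).

Definition tau_hat (beta gamma : R) (N : nat) (f : Z2 -> R) (x : Z2) : R :=
  tau beta f x / t_hat beta gamma N.

Definition trap_set (beta gamma delta : R) (N : nat) (f : Z2 -> R) : set Z2 :=
  [set x | V N x /\ delta <= tau_hat beta gamma N f x].

Definition sup_dist (x y : Z2) : int := Num.max `|x.1 - y.1| `|x.2 - y.2|.

(* Equals +oo when A is empty. *)
Definition dist_to (x : Z2) (A : set Z2) : \bar R :=
  ereal_inf [set (sup_dist x y)%:~R%:E | y in A].

End trap_model.

(* Main.v *)
Require Import Defs.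
From HB Require Import structures.
From mathcomp Require Import all_boot all_order all_algebra.
From mathcomp Require Import all_classical all_reals all_analysis.
From mathcomp Require Import measurable_realfun zify ring lra.

Import Order.TTheory GRing.Theory Num.Theory.
Import numFieldNormedType.Exports.

Local Open Scope classical_set_scope.
Local Open Scope ring_scope.

(** A union bound suffices. The variance of [h_y] is at most [g ln N + C], so
    by Chernoff's bound a given site is in the trap set with probability at
    most [N^-2 (ln N)^A e^B]. There are at most [(4 N / r_N + 1)^2] sites at
    distance at most [2 N / r_N] of [x], and [r_N] grows faster than any power
    of [ln N].

    The variance bound compares the Green function of the box with the one of
    the box of twice the size centred at [y], which is explicit: expanding in
    Fourier modes in the first coordinate and solving the resulting
    one-dimensional recurrences in the second one, its value at the centre is
    a sum over odd frequencies which is asymptotically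
    [(4 / pi) (1 + 1/3 + 1/5 + ...)], that is [(2 / pi) ln N + O(1)]. Only an
    upper bound is needed, so it is enough that the explicit function be
    nonnegative and superharmonic. *)

(** * Superharmonic upper bounds for the Green function *)

Lemma measure_bigsetU_seq_le {R : realType} d (T : measurableType d)
    (mu : {measure set T -> \bar R}) (I : Type) (s : seq I) (F : I -> set T) :
  (forall i, measurable (F i)) ->
  (mu (\big[setU/set0]_(i <- s) F i) <= \sum_(i <- s) mu (F i))%E.
Proof.
move=> mF; elim: s => [|i s IHs]; first by rewrite !big_nil measure0.
rewrite !big_cons (le_trans (measureU2 _ _ _))// ?leeD2l//.
exact: bigsetU_measurable.
Qed.

Lemma sum_pred1_seq {R : pzSemiRingType} (I : eqType) (s : seq I) (b : I) (f : I -> R) :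
  uniq s -> \sum_(z <- s) (z == b)%:R * f z = (b \in s)%:R * f b.
Proof.
move=> us; case: (boolP (b \in s)) => bs.
  rewrite (bigD1_seq b)//= eqxx big1 ?addr0// => z /negbTE ->.
  by rewrite mul0r.
rewrite mul0r big1_seq// => z /= zs; case: eqP => [zb|_]; last by rewrite mul0r.
by rewrite -zb zs in bs.
Qed.

Definition nbrs (a : Z2) : seq Z2 :=
  [:: (a.1 + 1, a.2); (a.1 - 1, a.2); (a.1, a.2 + 1); (a.1, a.2 - 1)].

Lemma srw_stepE (R : realType) (a z : Z2) :
  srw_step a z = 4^-1 * \sum_(b <- nbrs a) (z == b)%:R :> R.
Proof.
rewrite /srw_step !big_cons big_nil addr0 -!natrD; case: ifPn => az.
  rewrite (_ : (_ + _)%N = 1%N) ?mulr1//; move: az.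
  by case: a z => [a1 a2] [z1 z2]; rewrite !xpair_eqE /=; lia.
rewrite (_ : (_ + _)%N = 0%N) ?mulr0//; move: az.
by case: a z => [a1 a2] [z1 z2]; rewrite !xpair_eqE /=; lia.
Qed.

Lemma srw_step_ge0 (R : realType) (a z : Z2) : 0 <= srw_step a z :> R.
Proof. by rewrite /srw_step; case: ifP => // _; rewrite invr_ge0. Qed.

Lemma sum_srw_step_le (R : realType) (s : seq Z2) (a : Z2) (u : Z2 -> R) :
  uniq s -> (forall z, 0 <= u z) ->
  \sum_(z <- s) srw_step a z * u z <= 4^-1 * \sum_(b <- nbrs a) u b.
Proof.
move=> us u0; under eq_bigr do rewrite srw_stepE -mulrA mulr_suml.
rewrite -mulr_sumr exchange_big/= ler_pM2l ?invr_gt0//.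
apply: ler_sum => b _; rewrite sum_pred1_seq// ler_piMl//.
by case: (_ \in _).
Qed.

Section green_bound.
Context {R : realType} d (W : measurableType d) (Px : Z2 -> probability W R).
Variable S : nat -> W -> Z2.
Hypothesis hS : is_srw Px S.
Variables (D : set Z2) (s : seq Z2).
Hypothesis us : uniq s.
Hypothesis Ds : forall z, D z <-> z \in s.

Let mSD n : measurable [set w | D (S n w)].
Proof.
rewrite (_ : [set w | _] = \big[setU/set0]_(z <- s) [set w | S n w = z]).
  by apply: bigsetU_measurable => z _; exact: hS.1.
rewrite -bigcup_seq; apply/seteqP; split => w /=.
  by move/Ds => Ss; exists (S n w).
by move=> [z /= zs ->]; exact/Ds.
Qed.

(** [is_srw] gives the walk through the probabilities of finite trajectories, so conditioning on the
    past is encoded by carrying a whole prefix [p] up to time [n]. *)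
Let follow_stay (p : nat -> Z2) n m y := [set w |
  [/\ forall i, (i <= n)%N -> S i w = p i,
      forall j, (n < j <= n + m)%N -> D (S j w) & S (n + m)%N w = y]].

Let measurable_forall (Q : pred nat) (F : nat -> set W) :
  (forall i, measurable (F i)) -> measurable [set w | forall i, Q i -> F i w].
Proof.
move=> mF; rewrite (_ : [set w | _] = \bigcap_(i in [set i | Q i]) F i).
  by apply: bigcap_measurableType => i _.
by apply/seteqP; split.
Qed.

Let measurable_follow_stay p n m y : measurable (follow_stay p n m y).
Proof.
rewrite (_ : follow_stay p n m y = [set w | forall i, (i <= n)%N -> S i w = p i] `&`
  ([set w | forall j, (n < j <= n + m)%N -> D (S j w)] `&`
  [set w | S (n + m)%N w = y])).
  apply: measurableI; first by apply: measurable_forall => i; exact: hS.1.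
  by apply: measurableI; [exact: measurable_forall|exact: hS.1].
by apply/seteqP; split => w /= [] // a [].
Qed.

Variables (y : Z2) (u : Z2 -> R).
Hypothesis u_ge0 : forall z, 0 <= u z.
Hypothesis u_super : forall a, D a ->
  (a == y)%:R + 4^-1 * \sum_(b <- nbrs a) u b <= u a.

Let weight x (p : nat -> Z2) n : R :=
  (p 0%N == x)%:R * \prod_(i < n) srw_step (p i) (p i.+1).

Let weight_ge0 x p n : 0 <= weight x p n.
Proof. by rewrite mulr_ge0// prodr_ge0// => i _; exact: srw_step_ge0. Qed.

(* Induction on [M] for all prefixes [p] at once: the first step after time [n]
   extends the prefix. *)
Let occupation_le M x p n : D (p n) ->
  (\sum_(m < M) Px x (follow_stay p n m y) <= (weight x p n * u (p n))%:E)%E.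
Proof.
elim: M n p => [|M IHM] n p Dpn.
  by rewrite big_ord0 lee_fin mulr_ge0.
rewrite big_ord_recl.
pose p' z i := if i == n.+1 then z else p i.
have p'n z i : (i <= n)%N -> p' z i = p i.
  by rewrite /p' => ?; case: eqP => // ?; lia.
have p'n1 z : p' z n.+1 = z by rewrite /p' eqxx.
have step0 : (Px x (follow_stay p n 0 y) <= (weight x p n * (p n == y)%:R)%:E)%E.
  have [pny|pny] := eqVneq (p n) y.
    rewrite mulr1 -hS.2 le_measure ?inE//.
      by apply: measurable_forall => i; exact: hS.1.
    by move=> w /= [].
  rewrite (_ : follow_stay _ _ _ _ = set0) ?measure0 ?mulr0//.
  apply/seteqP; split => // w [/= pS _]; rewrite addn0 pS// => e.
  by rewrite e eqxx in pny.
have stepS (m : nat) : (Px x (follow_stay p n m.+1 y)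
    <= \sum_(z <- s) Px x (follow_stay (p' z) n.+1 m y))%E.
  apply: (@le_trans _ _ (Px x (\big[setU/set0]_(z <- s) follow_stay (p' z) n.+1 m y)));
    last exact: measure_bigsetU_seq_le.
  rewrite le_measure ?inE//; first exact: bigsetU_measurable.
  rewrite -bigcup_seq => w /= [pS DS Sy]; exists (S n.+1 w).
    by apply/Ds/DS; lia.
  split.
  - move=> i; rewrite leq_eqVlt => /predU1P[->|/= ilt]; first by rewrite p'n1.
    by rewrite p'n// pS.
  - by move=> j jnm; apply: DS; lia.
  - by rewrite addSnnS.
(* The visit at time [n] and the later visits match the two terms on the left of [u_super] at
   [p n]. *)
apply: (@le_trans _ _ ((weight x p n * (p n == y)%:R)%:E +
    \sum_(z <- s) (weight x p n * srw_step (p n) z * u z)%:E)%E); last first.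
  rewrite sumEFin -EFinD lee_fin.
  under eq_bigr do rewrite -mulrA.
  rewrite -mulr_sumr -mulrDr ler_wpM2l//.
  by rewrite (le_trans _ (u_super _ Dpn))// lerD2l sum_srw_step_le.
apply: leeD => //.
apply: (@le_trans _ _ (\sum_(m < M) \sum_(z <- s) Px x (follow_stay (p' z) n.+1 m y))%E).
  by apply: lee_sum => m _; exact: stepS.
rewrite exchange_big/= big_seq [leRHS]big_seq; apply: lee_sum => z zs.
apply: (le_trans (IHM n.+1 (p' z) _)); first by rewrite p'n1; exact/Ds.
rewrite lee_fin p'n1 /weight big_ord_recr/= p'n1 !p'n//.
rewrite le_eqVlt; apply/orP; left; apply/eqP.
rewrite mulrA; congr (_ * _ * _ * _).
by apply: eq_bigr => i _; rewrite !p'n// ltnW.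
Qed.

Let lt_exit_time n (w : nat -> Z2) :
  (n%:R%:E < exit_time D w :> \bar R)%E <-> (forall i, (i <= n)%N -> D (w i)).
Proof.
split => [nt i ilen|Dw].
  apply: contrapT => Dwi; move: nt; apply/negP; rewrite -leNgt.
  apply: (@le_trans _ _ (i%:R%:E)); last by rewrite lee_fin ler_nat.
  by apply: ereal_inf_lbound; exists i.
apply: (@lt_le_trans _ _ (n.+1%:R%:E)); first by rewrite lte_fin ltr_nat.
apply: le_ereal_inf_tmp => _ [i /= Dwi <-]; rewrite lee_fin ler_nat ltnNge.
by apply/negP => /Dw.
Qed.

(** The Green function is the limit of the expected numbers of visits to [y] before a horizon [M],
    and [occupation_le] bounds these uniformly in [M]. *)
Lemma green_le x : (green Px S D x y <= (u x)%:E)%E.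
Proof.
pose B n := [set w | (forall i, (i <= n)%N -> D (S i w)) /\ S n w = y].
have mB n : measurable (B n).
  by apply: measurableI; [exact: measurable_forall | exact: hS.1].
rewrite /green (_ : (fun w => _) = (fun w => \sum_(n <oo) (\1_(B n) w)%:E)%E); last first.
  apply/funext => w; rewrite eseries_mkcond; apply: eq_eseriesr => n _.
  rewrite indicE; case: ifPn => nt.
    case: eqP => Sy; [rewrite mem_set// | rewrite memNset//]; last by case.
    by split => //; exact/lt_exit_time.
  by rewrite memNset// => -[/lt_exit_time nt'] _; rewrite nt' in nt.
rewrite integral_nneseries//; last first.
  by move=> n; exact/measurable_EFinP.
apply: lime_le.
  by apply: is_cvg_ereal_nneg_natsum => n _; exact: integral_ge0.
near=> M; rewrite big_mkord.
under eq_bigr do rewrite integral_indic// setIT.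
(* Splitting according to the starting point [z] gives prefixes of length zero; the weight of such a
   prefix vanishes unless [z = x]. *)
apply: (@le_trans _ _ (\sum_(z <- s) \sum_(m < M) Px x (follow_stay (cst z) 0 m y))%E).
  rewrite exchange_big; apply: lee_sum => m _.
  apply: (@le_trans _ _ (Px x (\big[setU/set0]_(z <- s) follow_stay (cst z) 0 m y)));
    last exact: measure_bigsetU_seq_le.
  rewrite le_measure ?inE//; first exact: bigsetU_measurable.
  rewrite -bigcup_seq => w /= [DS Sy]; exists (S 0%N w); first exact/Ds/DS.
  split => //; first by move=> i; rewrite leqn0 => /eqP ->.
  by move=> j jm; apply: DS; lia.
apply: (@le_trans _ _ (\sum_(z <- s) ((z == x)%:R * u z)%:E)%E).
  rewrite big_seq [leRHS]big_seq; apply: lee_sum => z zs.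
  by have := @occupation_le M x (cst z) 0%N ((Ds z).2 zs); rewrite /weight big_ord0 mulr1.
rewrite sumEFin lee_fin sum_pred1_seq//.
by case: (_ \in _); rewrite ?mul1r// mul0r.
Unshelve. all: by end_near.
Qed.

End green_bound.

(** * The explicit Green function of a box *)

Section box_minimum_principle.
Context {R : realType} (M : nat) (u : Z2 -> R).
Hypothesis u_out : forall z, ~ V M z -> u z = 0.
Hypothesis u_super : forall a, V M a -> 4^-1 * \sum_(b <- nbrs a) u b <= u a.

Lemma V_finite_range (z : Z2) : V M z ->
  exists i j : 'I_(M.*2), z = (i%:Z - M%:Z, j%:Z - M%:Z).
Proof.
case: z => a b [/= aM bM].
have ia : (absz (a + M%:Z)%R < M.*2)%N by lia.
have ib : (absz (b + M%:Z)%R < M.*2)%N by lia.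
by exists (Ordinal ia), (Ordinal ib) => /=; congr (_, _); lia.
Qed.

(* A negative minimum would propagate along a line up to the boundary. *)
Lemma box_superharmonic_ge0 z : 0 <= u z.
Proof.
rewrite leNgt; apply/negP => uz0.
have Vz : V M z by apply: contrapT => /u_out uz; rewrite uz ltxx in uz0.
have [i0 [j0 zij]] := V_finite_range z Vz.
pose pt (ij : 'I_(M.*2) * 'I_(M.*2)) : Z2 := (ij.1%:Z - M%:Z, ij.2%:Z - M%:Z).
have [ij _ ijmin] := @arg_minP _ _ _ (i0, j0) xpredT (u \o pt) isT.
set p := pt ij in ijmin; set m := u p.
have m0 : m < 0 by apply: le_lt_trans uz0; rewrite zij; exact: (ijmin (i0, j0)).
have um b : m <= u b.
  have [Vb|/u_out ->] := pselect (V M b); last exact: ltW.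
  by have [i [j ->]] := V_finite_range b Vb; exact: (ijmin (i, j)).
have um_in b : u b = m -> V M b.
  by move=> ub; apply: contrapT => /u_out ub0; rewrite -ub ub0 ltxx in m0.
have line (k : nat) : u (p.1 + k%:Z, p.2) = m.
  elim: k => [|k IHk]; first by rewrite addr0 /m; case: (p).
  apply/eqP; rewrite eq_le um andbT.
  (* Four values that are at least [m], with mean at most [m], are all equal to [m]. *)
  have := u_super _ (um_in _ IHk); rewrite IHk !big_cons big_nil addr0 /=.
  have -> : p.1 + k%:Z + 1 = p.1 + k.+1%:Z by lia.
  move: (um (p.1 + k%:Z - 1, p.2)) (um (p.1 + k%:Z, p.2 + 1)) (um (p.1 + k%:Z, p.2 - 1)).
  lra.
(* A shift by [2 M], the width of the box, leaves it. *)
have := um_in _ (line M.*2); have := um_in _ (line 0%N).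
by rewrite /V /=; lia.
Qed.

End box_minimum_principle.

(** * Elementary trigonometric estimates and sums *)

Section trigonometric_bounds.
Context {R : realType}.
Implicit Types x : R.

Lemma cos_ge1B x : 0 <= x -> 1 - x <= cos x.
Proof.
move=> x0.
have [|c _] := @MVT_segment R cos (- sin) 0 x x0 _.
  by apply: continuous_subspaceT; exact: continuous_cos.
rewrite cos0 !subr0 => /eqP; rewrite subr_eq => /eqP ->.
by rewrite !fctE; have := sin_le1 c; nra.
Qed.

Lemma sin_ge_sqr x : 0 <= x -> x * (1 - x) <= sin x.
Proof.
move=> x0.
have [|c] := @MVT_segment R sin cos 0 x x0 _.
  by apply: continuous_subspaceT; exact: continuous_sin.
rewrite in_itv/= sin0 !subr0 => /andP[c0 cx] ->.
by have := cos_ge1B c c0; nra.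
Qed.

Lemma sin_natr_pi (n : nat) : sin (n%:R * pi) = 0 :> R.
Proof.
by rewrite mulr_natl -[_ *+ _]add0r (alternatingn (@sinDpi R)) sin0 mulr0.
Qed.

Lemma cos_odd_pihalf (n : nat) : cos ((n.*2.+1)%:R * pi / 2) = 0 :> R.
Proof.
have -> : (n.*2.+1)%:R * pi / 2 = n%:R * pi + pi / 2 :> R.
  by rewrite -addn1 -muln2 natrD natrM; field.
by rewrite cosDpihalf sin_natr_pi oppr0.
Qed.

(** Telescoping: [2 sin x cos ((2 i + 1) x) = sin ((2 i + 2) x) - sin (2 i x)]. *)
Lemma sum_cos_odd (n : nat) x :
  2 * sin x * (\sum_(i < n) cos (i.*2.+1%:R * x)) = sin (n.*2%:R * x).
Proof.
elim: n => [|n IHn]; first by rewrite big_ord0 mulr0 mul0r sin0.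
rewrite big_ord_recr/= mulrDr IHn.
have -> : n.*2%:R * x = n.*2.+1%:R * x - x.
  by rewrite -[n.*2.+1]addn1 natrD; ring.
have -> : n.+1.*2%:R * x = n.*2.+1%:R * x + x.
  by rewrite doubleS -[n.*2.+2]addn1 natrD; ring.
by rewrite sinB sinD; ring.
Qed.

End trigonometric_bounds.

(** * Separation of variables in the box *)

Section box_green.
Context {R : realType} (M : nat).
Hypothesis M0 : (0 < M)%N.

Let M0' : (0 : R) < M%:R. Proof. by rewrite ltr0n. Qed.

(** These are the frequencies for which [cos (angle i * _)] vanishes at [M] and [- M], as the
    Dirichlet condition requires. *)
Definition angle (i : nat) : R := i.*2.+1%:R * pi / (2 * M%:R).

Lemma angle_gt0 i : 0 < angle i.
Proof. by rewrite /angle !mulr_gt0 ?invr_gt0 ?mulr_gt0 ?pi_gt0. Qed.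

Lemma angle_ltpi i : (i < M)%N -> angle i < pi.
Proof.
move=> iM; rewrite /angle ltr_pdivrMr ?mulr_gt0// mulrC ltr_pM2l ?pi_gt0//.
by rewrite -natrM ltr_nat; lia.
Qed.

(* [ch i] and [sh i] are the hyperbolic cosine and sine of the decay rate in
   the second direction of the mode of frequency [angle i] in the first one,
   and [ex i] is its inverse exponential. *)
Definition ch (i : nat) : R := 2 - cos (angle i).
Definition sh (i : nat) : R := Num.sqrt (ch i ^+ 2 - 1).
Definition ex (i : nat) : R := ch i - sh i.

Lemma sh2 i : sh i ^+ 2 = ch i ^+ 2 - 1.
Proof.
rewrite sqr_sqrtr// subr_ge0 exprn_ege1// /ch.
by have := cos_le1 (angle i); lra.
Qed.

Lemma sh_ge0 i : 0 <= sh i. Proof. exact: sqrtr_ge0. Qed.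

Lemma ex_gt0 i : 0 < ex i.
Proof.
have := sh2 i; have := sh_ge0 i; have := cos_le1 (angle i).
by rewrite /ex /ch; nra.
Qed.

(** This is the characteristic equation of the recurrence in [profile_rec]. *)
Lemma ex_quadratic i : ex i ^+ 2 + 1 = 2 * ch i * ex i.
Proof. by have := sh2 i; rewrite /ex; nra. Qed.

Lemma cos_angle i : cos (angle i) = 1 - 2 * sin (angle i / 2) ^+ 2.
Proof.
rewrite -[in LHS](_ : (angle i / 2) *+ 2 = angle i); last by rewrite -mulr_natr; field.
by rewrite cos_mulr2n cos2sin2; ring.
Qed.

Lemma sin_half_angle_gt0 i : (i < M)%N -> 0 < sin (angle i / 2).
Proof.
move=> /angle_ltpi ipi; apply: sin_gt0_pi.
by have := angle_gt0 i; lra.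
Qed.

(** With [y = sin (angle i / 2) ^+ 2] one has [ch i = 1 + 2 y], hence [sh i ^+ 2 = 4 y + 4 y^2]. *)
Lemma sh_ge i : (i < M)%N -> 2 * sin (angle i / 2) <= sh i.
Proof.
move=> /sin_half_angle_gt0 s0.
rewrite -(@ler_pXn2r _ 2) ?nnegrE ?sh_ge0 ?mulr_ge0// ?(ltW s0)//.
rewrite sh2 /ch cos_angle; set y := sin _ ^+ 2.
by have : 0 <= y by [rewrite sqr_ge0]; rewrite exprMn -/y; nra.
Qed.

Lemma sh_gt0 i : (i < M)%N -> 0 < sh i.
Proof.
move=> iM; apply: lt_le_trans (sh_ge i iM).
by rewrite mulr_gt0// sin_half_angle_gt0.
Qed.

(** The term [2 / angle i] will sum to the logarithm, while the error [4] stays bounded after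
    averaging over [i]. *)
Lemma sh_inv_le i : (i < M)%N -> 2 / sh i <= 2 / angle i + 4.
Proof.
move=> iM; have t0 := angle_gt0 i; have tpi := angle_ltpi i iM.
have shi := sh_ge i iM; have sh0 := sh_gt0 i iM.
rewrite ler_pdivrMr//.
have [t1|t1] := leP (angle i) 1.
  have := sin_ge_sqr (angle i / 2) ltac:(lra) => st.
  have hs : angle i * (1 - angle i / 2) <= sh i by lra.
  (* For [t = angle i <= 1] this product is [2 + 3 t - 2 t^2], which is at least [2]. *)
  apply: (@le_trans _ _ ((2 / angle i + 4) * (angle i * (1 - angle i / 2)))).
    have -> : (2 / angle i + 4) * (angle i * (1 - angle i / 2)) =
        (2 + 4 * angle i) * (1 - angle i / 2) by field; rewrite gt_eqF.
    by nra.
  by rewrite ler_wpM2l// addr_ge0// divr_ge0// ltW.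
(* Here [sin (angle i / 2) >= sin (1 / 2) >= 1 / 4], so [sh i >= 1 / 2] and the constant [4] alone
   suffices. *)
have : sin (1 / 2 : R) <= sin (angle i / 2).
  rewrite ltW// ltr_sin ?in_itv/=; [lra| |]; have := @pi_ge2 R; lra.
have := sin_ge_sqr (1 / 2 : R) ltac:(lra) => s2 s3.
have : 0 <= 2 / angle i by rewrite divr_ge0// ltW.
by nra.
Qed.

(** With [ex i = exp (- k)] this is [(2 / sh i) sinh (k (M - t)) / cosh (k M)], written with
    nonnegative powers of [ex i]. *)
Definition profile (i t : nat) : R :=
  2 / sh i * ((ex i ^+ t - ex i ^+ (M.*2 - t)) / (1 + ex i ^+ M.*2)).

Let den_gt0 i : 0 < 1 + ex i ^+ M.*2.
Proof. by rewrite ltr_wpDr// exprn_ge0// ltW// ex_gt0. Qed.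

(** Both [ex i ^+ t] and its reflection [ex i ^+ (M.*2 - t)] solve the recurrence, by
    [ex_quadratic]; the bound on [t] keeps the subtractions exact. *)
Lemma profile_rec i t : (t.+2 <= M.*2)%N ->
  profile i t + profile i t.+2 = 2 * ch i * profile i t.+1.
Proof.
move=> tM; rewrite /profile -mulrDr -mulrDl [RHS]mulrCA; congr (_ * _).
rewrite mulrA; congr (_ / _).
have [k Mk] : exists k, M.*2 = (t.+2 + k)%N by exists (M.*2 - t.+2)%N; lia.
have -> : (M.*2 - t = k.+2)%N by lia.
have -> : (M.*2 - t.+1 = k.+1)%N by lia.
have -> : (M.*2 - t.+2 = k)%N by lia.
have q1 r : ex i ^+ r + ex i ^+ r.+2 = 2 * ch i * ex i ^+ r.+1.
  have -> : ex i ^+ r + ex i ^+ r.+2 = ex i ^+ r * (ex i ^+ 2 + 1) by rewrite !exprS; ring.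
  by rewrite ex_quadratic exprS; ring.
by rewrite mulrBr -!q1; ring.
Qed.

(** The factor [2 / sh i] normalises this defect: counted for both neighbours across the axis it is
    [4], and the mean over four neighbours turns it into [1]. *)
Lemma profile_rec0 i : (i < M)%N -> profile i 1 = ch i * profile i 0 - 2.
Proof.
move=> iM; have s0 := sh_gt0 i iM; have d0 := den_gt0 i.
have e : ex i * sh i = 1 - ch i * ex i.
  by have := ex_quadratic i; rewrite /ex; have := sh2 i; nra.
rewrite /profile subn0 expr0 expr1.
have Mk : M.*2 = (M.*2 - 1).+1 by lia.
set k := (M.*2 - 1)%N in Mk *.
suff : ch i * (1 - ex i ^+ M.*2) - (ex i - ex i ^+ k) = sh i * (1 + ex i ^+ M.*2).
  move=> h; apply/eqP; rewrite -subr_eq0; apply/eqP.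
  have -> : 2 / sh i * ((ex i - ex i ^+ k) / (1 + ex i ^+ M.*2)) -
    (ch i * (2 / sh i * ((1 - ex i ^+ M.*2) / (1 + ex i ^+ M.*2))) - 2) =
    2 - 2 / sh i / (1 + ex i ^+ M.*2) * (ch i * (1 - ex i ^+ M.*2) - (ex i - ex i ^+ k)).
    by field; rewrite !gt_eqF.
  by rewrite h; field; rewrite !gt_eqF.
rewrite Mk exprS.
have -> : sh i * (1 + ex i * ex i ^+ k) = sh i + ex i * sh i * ex i ^+ k by ring.
by rewrite e /ex; ring.
Qed.

Lemma profileM i : profile i M = 0.
Proof. by rewrite /profile -addnn addnK subrr mul0r mulr0. Qed.

Lemma profile0_le i : (i < M)%N -> profile i 0 <= 2 / sh i.
Proof.
move=> iM; rewrite /profile ler_piMr ?divr_ge0 ?sh_ge0// ler_pdivrMr// mul1r subn0.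
by rewrite expr0; have := exprn_ge0 M.*2 (ltW (ex_gt0 i)); lra.
Qed.

(* Each mode is harmonic for the walk off the axis [z.2 = 0]; on the axis the
   defects of harmonicity add up to a Dirac mass, by [mean_cos_angle]. *)
Definition modes (z : Z2) : R :=
  M%:R^-1 * \sum_(i < M) cos (angle i * z.1%:~R) * profile i (absz z.2).

Lemma modes_boundary z : absz z.1 = M \/ absz z.2 = M -> modes z = 0.
Proof.
move=> zM; rewrite /modes big1 ?mulr0// => i _.
case: zM => [zM|->]; last by rewrite profileM mulr0.
have -> : cos (angle i * z.1%:~R) = cos (angle i * M%:R).
  have [->|->] : z.1 = M%:Z \/ z.1 = - M%:Z by lia.
    by [].
  by rewrite mulrNz mulrN cosN.
rewrite (_ : angle i * M%:R = i.*2.+1%:R * pi / 2) ?cos_odd_pihalf ?mul0r//.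
by rewrite /angle; field; rewrite gt_eqF.
Qed.

(** For [x != 0], [sum_cos_odd] at [y = |x| pi / (2 M)] has right-hand side [sin (|x| pi) = 0],
    whereas [sin y > 0]. *)
Lemma mean_cos_angle (x : int) : (absz x < M)%N ->
  M%:R^-1 * (\sum_(i < M) cos (angle i * x%:~R)) = (x == 0)%:R.
Proof.
move=> xM; have [->|x0] := eqVneq x 0.
  under eq_bigr do rewrite mulr0 cos0.
  by rewrite sumr_const card_ord mulVf// gt_eqF.
have -> : \sum_(i < M) cos (angle i * x%:~R) =
    \sum_(i < M) cos (i.*2.+1%:R * ((absz x)%:R * pi / (2 * M%:R))).
  apply: eq_bigr => i _; rewrite -cos_norm normrM (gtr0_norm (angle_gt0 _)).
  rewrite -intr_norm -abszE; congr cos.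
  by rewrite /angle pmulrn; field; rewrite gt_eqF.
set y := _ * pi / _.
have y0 : 0 < sin y.
  apply: sin_gt0_pi; rewrite /y !mulr_gt0 ?invr_gt0 ?mulr_gt0 ?pi_gt0 ?ltr0n ?absz_gt0//=.
  rewrite ltr_pdivrMr ?mulr_gt0// mulrC ltr_pM2l ?pi_gt0// -natrM ltr_nat; lia.
have := sum_cos_odd M y.
have -> : M.*2%:R * y = (absz x)%:R * pi.
  by rewrite /y -muln2 natrM; field; rewrite gt_eqF.
rewrite sin_natr_pi => /eqP; rewrite mulf_eq0 gt_eqF ?mulr_gt0//= => /eqP ->.
by rewrite mulr0.
Qed.

(** In each mode the horizontal neighbours contribute a factor [2 cos (angle i)] and the vertical
    ones [2 ch i]; these add up to [4] by the choice of [ch], leaving the defect on the axis. *)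
Lemma modes_laplacian (a : Z2) : V M a ->
  (a == 0)%:R + 4^-1 * (\sum_(b <- nbrs a) modes b) = modes a.
Proof.
case: a => x y [/= xM yM].
rewrite !big_cons big_nil addr0 /modes /=.
have Py (i : 'I_M) : profile i (absz (y + 1)) + profile i (absz (y - 1)) =
    2 * ch i * profile i (absz y) - 4 * (y == 0)%:R.
  have [->|y0] := eqVneq y 0.
    rewrite add0r sub0r abszN absz1 absz0 profile_rec0//=; ring.
  rewrite mulr0 subr0.
  have [t [-> h]] : exists t, absz y = t.+1 /\
     ((absz (y + 1) = t.+2 /\ absz (y - 1) = t) \/ (absz (y + 1) = t /\ absz (y - 1) = t.+2)).
    by exists (absz y).-1; lia.
  rewrite -profile_rec; last by lia.
  by case: h => -[-> ->] //; rewrite addrC.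
have Cx (i : 'I_M) : cos (angle i * (x + 1)%:~R) + cos (angle i * (x - 1)%:~R) =
    2 * cos (angle i) * cos (angle i * x%:~R).
  have -> : angle i * (x + 1)%:~R = angle i * x%:~R + angle i by ring.
  have -> : angle i * (x - 1)%:~R = angle i * x%:~R - angle i by ring.
  by rewrite cosD cosB; ring.
rewrite -!mulrDr -!big_split/=.
have -> : \sum_(i < M) (cos (angle i * (x + 1)%:~R) * profile i (absz y) +
    (cos (angle i * (x - 1)%:~R) * profile i (absz y) +
     (cos (angle i * x%:~R) * profile i (absz (y + 1)) +
      cos (angle i * x%:~R) * profile i (absz (y - 1))))) =
   4 * (\sum_(i < M) cos (angle i * x%:~R) * profile i (absz y)) -
   4 * (y == 0)%:R * (\sum_(i < M) cos (angle i * x%:~R)).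
  rewrite !mulr_sumr -sumrB; apply: eq_bigr => i _.
  rewrite addrA -mulrDl -mulrDr Cx Py /ch; ring.
rewrite mulrBr mulrBr (mulrCA _ (4 * _)) mean_cos_angle; last by lia.
have -> : (x, y) == 0 = (x == 0) && (y == 0) by [].
by case: (x == 0); case: (y == 0) => /=; field; rewrite gt_eqF.
Qed.

(** The extension by zero is what the minimum principle [box_superharmonic_ge0] asks for. *)
Definition box_green (z : Z2) : R :=
  if (absz z.1 < M)%N && (absz z.2 < M)%N then modes z else 0.

Let inV z : V M z <-> (absz z.1 < M)%N && (absz z.2 < M)%N.
Proof. by case: z => x y; rewrite /V /=; lia. Qed.

(** The cut-off does no harm: a neighbour of an interior site that falls outside lies on the
    boundary lines, where [modes] already vanishes. *)
Lemma box_green_laplacian (a : Z2) : V M a ->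
  (a == 0)%:R + 4^-1 * (\sum_(b <- nbrs a) box_green b) = box_green a.
Proof.
move=> Va; rewrite {2}/box_green ifT; last exact/inV.
rewrite -modes_laplacian//; congr (_ + _ * _).
rewrite big_seq [RHS]big_seq; apply: eq_bigr => b ba.
rewrite /box_green; case: ifPn => // bV.
rewrite modes_boundary//; move: Va ba bV; case: a b => x y [x' y'].
by rewrite /nbrs !inE !xpair_eqE /V /=; lia.
Qed.

Lemma box_green_ge0 z : 0 <= box_green z.
Proof.
apply: (@box_superharmonic_ge0 R M) => [a Va|a Va].
  by rewrite /box_green ifF//; apply/negP => /inV.
by rewrite -box_green_laplacian// lerDr ler0n.
Qed.

Lemma sum_odd_inv_le (n : nat) :
  \sum_(i < n.+1) (i.*2.+1)%:R^-1 <= 1 + ln (n.*2.+1)%:R / 2 :> R.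
Proof.
elim: n => [|n IHn]; first by rewrite big_ord1 invr1 ln1 mul0r addr0.
rewrite big_ord_recr/=; set a : R := n.*2.+1%:R in IHn *.
have a0 : 0 < a by rewrite ltr0n.
have e : n.+1.*2.+1%:R = a + 2 :> R by rewrite doubleS -natrD addn2.
rewrite e; apply: (le_trans (lerD IHn (lexx _))).
(* The inequality [ln (1 - w) <= - w] with [w = 2 / (a + 2)] gives
   [1 / (a + 2) <= (ln (a + 2) - ln a) / 2]. *)
have := @le_ln1Dx R (- (2 / (a + 2))).
have -> : 1 + - (2 / (a + 2)) = a / (a + 2) by field; rewrite gt_eqF// addr_gt0.
rewrite ln_div ?posrE ?addr_gt0// => h.
have : 2 / (a + 2) < 1 by rewrite ltr_pdivrMr ?addr_gt0//; lra.
by move=> ?; have := h ltac:(lra); lra.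
Qed.

Lemma box_green0_le : box_green 0 <= 2 / pi * ln (M.*2)%:R + 6.
Proof.
rewrite /box_green /= M0 /modes /=.
apply: (@le_trans _ _ (M%:R^-1 * (\sum_(i < M) (4 * M%:R / pi * (i.*2.+1)%:R^-1 + 4)))).
  rewrite ler_wpM2l ?invr_ge0//; apply: ler_sum => i _.
  rewrite mulr0 cos0 mul1r (le_trans (profile0_le i _))//.
  rewrite (le_trans (sh_inv_le i _))// lerD2r le_eqVlt; apply/orP; left; apply/eqP.
  have : 0 < i.*2.+1%:R :> R by rewrite ltr0n.
  have := @pi_gt0 R; rewrite /angle; move: (pi : R) (i.*2.+1%:R : R) => p b p0 b0.
  by field; rewrite !gt_eqF.
rewrite big_split/= sumr_const card_ord -mulr_sumr mulrDr.
have -> : M%:R^-1 * (4 *+ M) = 4 :> R by rewrite -mulr_natr; field; rewrite gt_eqF.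
have -> : M%:R^-1 * (4 * M%:R / pi * \sum_(i < M) (i.*2.+1)%:R^-1) =
    4 / pi * \sum_(i < M) (i.*2.+1)%:R^-1 :> R.
  have := @pi_gt0 R; move: (pi : R) => p p0.
  by field; rewrite !gt_eqF.
have hs : \sum_(i < M) (i.*2.+1)%:R^-1 <= 1 + ln (M.*2)%:R / 2 :> R.
  case: (M) M0 => // n _; apply: (le_trans (sum_odd_inv_le n)).
  by rewrite lerD2l ler_pM2r// ler_ln ?posrE ?ltr0n// ler_nat; lia.
have p0 : 0 < 4 / pi :> R by rewrite divr_gt0 ?pi_gt0.
(* The final [6] is the [4] of [sh_inv_le] plus this [2], which bounds the first term [1] of the odd
   sum times [4 / pi]. *)
have p2 : 4 / pi <= 2 :> R by rewrite ler_pdivrMr ?pi_gt0//; have := @pi_ge2 R; lra.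
have := hs; rewrite -(ler_pM2l p0) mulrDr mulr1.
have -> : 4 / pi * (ln (M.*2)%:R / 2) = 2 / pi * ln (M.*2)%:R :> R.
  have := @pi_gt0 R; move: (pi : R) => p p0'.
  by field; rewrite gt_eqF.
lra.
Qed.

End box_green.

(** * Gaussian tails *)

Section normal_moments.
Context {R : realType}.
Notation mu := (@lebesgue_measure R).

(** The Radon-Nikodym derivative and [normal_pdf] have the same integrals over measurable sets,
    hence agree almost everywhere. *)
Lemma ge0_integral_normal_prob (m s : R) (f : R -> \bar R) :
  (forall x, (0 <= f x)%E) -> measurable_fun setT f ->
  (\int[normal_prob m s]_x f x = \int[mu]_x (f x * (normal_pdf m s x)%:E))%E.
Proof.
move=> f0 mf.
pose nu := [the probability _ _ of normal_prob m s].
have numu := @normal_prob_dominates R m s : nu `<< mu.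
pose rn := Radon_Nikodym_SigmaFinite.f nu mu.
have mrn : measurable_fun setT rn.
  exact: measurable_int (Radon_Nikodym_SigmaFinite.f_integrable numu).
have mpdf : measurable_fun setT (fun x => (normal_pdf m s x)%:E).
  by apply/measurable_EFinP; exact: measurable_normal_pdf.
rewrite -(@Radon_Nikodym_SigmaFinite.change_of_variables _ _ _ nu mu numu)//.
apply: ae_eq_integral => //; [exact: emeasurable_funM..|].
apply: ae_eqe_mul2l; apply: integral_ae_eq => //.
  exact: Radon_Nikodym_SigmaFinite.f_integrable.
by move=> E _ mE; rewrite -Radon_Nikodym_SigmaFinite.f_integral.
Qed.

(* Completing the square: [expR (t x)] times the density of [N(m, s^2)] is a
   multiple of the density of [N(m + s^2 t, s^2)]. *)
Lemma normal_prob_expR (m s t : R) : s != 0 ->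
  (\int[normal_prob m s]_x (expR (t * x))%:E
   = (expR (t * m + s ^+ 2 * t ^+ 2 / 2))%:E)%E.
Proof.
move=> s0; rewrite ge0_integral_normal_prob; last 2 first.
- by move=> x; rewrite lee_fin expR_ge0.
- by apply/measurable_EFinP; apply: measurableT_comp => //; exact: measurable_funM.
have E x : expR (t * x) * normal_pdf m s x =
    expR (t * m + s ^+ 2 * t ^+ 2 / 2) * normal_pdf (m + s ^+ 2 * t) s x.
  rewrite !normal_pdfE//= mulrCA [RHS]mulrCA; congr (_ * _).
  by rewrite /normal_fun -!expRD; congr expR; field.
under eq_integral do rewrite -EFinM E EFinM.
rewrite integralZl//; last exact: integrable_normal_pdf.
by rewrite integral_normal_pdf mule1.
Qed.

(* [expR (- a x^2)] times the density of [N(0, s^2)] is a multiple of the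
   density of [N(0, s'^2)], where [s'^-2 = s^-2 + 2 a]. *)
Lemma normal_prob_expRNsqr (s a : R) : s != 0 -> 0 < a ->
  (\int[normal_prob 0%R s]_x (expR (- (a * x ^+ 2)))%:E
   = ((Num.sqrt (1 + 2 * a * s ^+ 2))^-1)%:E)%E.
Proof.
move=> s0 a0; rewrite ge0_integral_normal_prob; last 2 first.
- by move=> x; rewrite lee_fin expR_ge0.
- apply/measurable_EFinP; apply: measurableT_comp => //=.
  apply: measurableT_comp => //=; apply: measurable_funM => //=.
have s20 : 0 < s ^+ 2 by rewrite exprn_even_gt0.
set q := Num.sqrt _.
have q20 : 0 < 1 + 2 * a * s ^+ 2 by have := mulr_gt0 a0 s20; lra.
have q0 : 0 < q by rewrite sqrtr_gt0.
have qq : q ^+ 2 = 1 + 2 * a * s ^+ 2 by rewrite sqr_sqrtr// ltW.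
have sq0 : s / q != 0 by rewrite mulf_neq0// invr_eq0 gt_eqF.
have E x : expR (- (a * x ^+ 2)) * normal_pdf 0 s x = q^-1 * normal_pdf 0 (s / q) x.
  rewrite !normal_pdfE//= mulrCA [RHS]mulrA; congr (_ * _).
    rewrite /normal_peak.
    have -> : (s / q) ^+ 2 * pi *+ 2 = q^-1 ^+ 2 * (s ^+ 2 * pi *+ 2) by ring.
    rewrite sqrtrM ?sqr_ge0// sqrtr_sqr gtr0_norm ?invr_gt0//.
    by rewrite invfM invrK mulKf// gt_eqF.
  rewrite /normal_fun -!expRD; congr expR.
  have : q ^+ 2 != 0 by rewrite gt_eqF// exprn_gt0.
  rewrite exprMn exprVn qq => h; field.
  by rewrite h s0.
under eq_integral do rewrite -EFinM E EFinM.
rewrite integralZl//; last exact: integrable_normal_pdf.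
by rewrite integral_normal_pdf mule1.
Qed.

End normal_moments.

(** * Mean, variance and tail of a Gaussian variable known by its law *)

Section gaussian.
Context {R : realType} d (T : measurableType d) (P : probability T R).
Variables (X : T -> R) (m s : R).
Hypothesis mX : measurable_fun setT X.
Hypothesis lawX : forall A : set R, measurable A ->
  P (X @^-1` A) = gaussian_law m s A.

Lemma gaussian_law_integral (f : R -> R) : (forall x, 0 <= f x) ->
  measurable_fun setT f ->
  (\int[P]_w (f (X w))%:E =
   if s == 0%R then (f m)%:E else \int[normal_prob m s]_x (f x)%:E)%E.
Proof.
move=> f0 mf.
pose Y : T -> g_sigma_algebraType R.-ocitv.-measurable := X.
have mY : measurable_fun setT Y by exact: mX.
transitivity (\int[pushforward P Y]_x (f x)%:E)%E.
  rewrite ge0_integral_pushforward//.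
  - by apply/measurable_EFinP; exact: mf.
  - by move=> x _ /=; rewrite lee_fin.
have [s0|s0] := eqVneq s 0.
  transitivity (\int[\d_(m : g_sigma_algebraType R.-ocitv.-measurable)]_x (f x)%:E)%E.
    by apply: eq_measure_integral => A mA _; rewrite [LHS]lawX// /gaussian_law s0 eqxx.
  rewrite integral_dirac// ?diracT ?mul1e//.
  by apply/measurable_EFinP; exact: mf.
by apply: eq_measure_integral => A mA _; rewrite [LHS]lawX// /gaussian_law (negbTE s0).
Qed.

Lemma gaussian_mgf (t : R) :
  (\int[P]_w (expR (t * X w))%:E = (expR (t * m + s ^+ 2 * t ^+ 2 / 2))%:E)%E.
Proof.
rewrite (@gaussian_law_integral (fun x => expR (t * x))).
- case: eqVneq => [->|s0]; last exact: normal_prob_expR.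
  by rewrite expr0n/= !mul0r addr0.
- by move=> x; exact: expR_ge0.
- by apply: measurableT_comp => //; exact: measurable_funM.
Qed.

Hypothesis EX : 'E_P[X]%E = 0%E.
Variable v : R.
Hypothesis varX : (covariance P X X <= v%:E)%E.

Let intX2 : (\int[P]_w (X w ^+ 2)%:E <= v%:E)%E.
Proof.
move: varX; rewrite covariance.unlock EX /= expectation.unlock; apply: le_trans.
rewrite le_eqVlt; apply/orP; left; apply/eqP; apply: eq_integral => w _ /=.
by rewrite !fctE /= subr0 expr2.
Qed.

Let mX2 : measurable_fun setT (fun w => (X w ^+ 2)%:E).
Proof. by apply/measurable_EFinP; exact: measurable_funX. Qed.

Let integrableX : P.-integrable setT (EFin \o X).
Proof.
apply: (@le_integrable _ _ _ _ setT _ _ (fun w => (1 + X w ^+ 2)%:E)) => //.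
- exact/measurable_EFinP.
- move=> w _ /=; rewrite lee_fin [leRHS]ger0_norm ?addr_ge0 ?sqr_ge0//.
  by rewrite -[X w ^+ 2]real_normK ?num_real//; have := sqr_ge0 (`|X w| - 1); nra.
- apply/integrableP; split.
    by apply/measurable_EFinP; apply: measurable_funD => //; exact/measurable_EFinP.
  under eq_integral do rewrite /= ger0_norm ?addr_ge0 ?sqr_ge0// EFinD.
  rewrite ge0_integralD//; last by move=> w _; rewrite lee_fin sqr_ge0.
  rewrite integral_cst// mul1e.
  apply: lte_add_pinfty; first by rewrite (le_lt_trans (probability_le1 P _))// ltry.
  exact: le_lt_trans intX2 (ltry _).
Qed.

(** Integrating [1 + t X <= expR (t X)] shows that the exponent of the Laplace transform is
    nonnegative for every [t]; as it vanishes at [0], its slope [m] there must vanish. *)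
Lemma gaussian_mean : m = 0.
Proof.
have ge0 t : 0 <= t * m + s ^+ 2 * t ^+ 2 / 2.
  rewrite -ler_expR expR0 -lee_fin -gaussian_mgf.
  have <- : (\int[P]_w (1 + t * X w)%:E = 1)%E.
    under eq_integral do rewrite EFinD EFinM.
    rewrite integralD//; last first.
    - exact: integrableZl.
    - exact: finite_measure_integrable_cst.
    rewrite integralZl// integral_cst// mul1e.
    rewrite -[RHS]adde0; congr (_ + _)%E; first exact: probability_setT.
    by move: EX; rewrite expectation.unlock => ->; rewrite mule0.
  apply: le_integral => //.
  - by under eq_fun do rewrite EFinD EFinM; apply: integrableD => //;
      [exact: finite_measure_integrable_cst | exact: integrableZl].
  - apply/integrableP; split.
      apply/measurable_EFinP; apply: measurableT_comp => //.
      exact: measurable_funM.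
    under eq_integral do rewrite /= ger0_norm ?expR_ge0//.
    by rewrite gaussian_mgf ltry.
  - by move=> w _; rewrite lee_fin expR_ge1Dx.
apply/eqP; rewrite -[_ == _]negbK; apply/negP => m0.
have m20 : 0 < m ^+ 2 by rewrite exprn_even_gt0.
(* This [t] is near the minimiser [- m / s^2]; the [+ 1] covers [s = 0]. *)
have := ge0 (- (m / (s ^+ 2 + 1))).
have s10 : 0 < s ^+ 2 + 1 by rewrite ltr_wpDl ?sqr_ge0.
have -> : - (m / (s ^+ 2 + 1)) * m + s ^+ 2 * (- (m / (s ^+ 2 + 1))) ^+ 2 / 2 =
   - (m ^+ 2 / (s ^+ 2 + 1) ^+ 2 * (s ^+ 2 / 2 + 1)) by field; rewrite gt_eqF.
rewrite oppr_ge0 leNgt => /negP; apply; apply: mulr_gt0.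
  by rewrite divr_gt0// exprn_gt0.
by rewrite ltr_wpDl// divr_ge0 ?sqr_ge0.
Qed.

(* [X^2 >= (1 - expR (- a X^2)) / a], whose Gaussian mean tends to [s^2] as
   [a] tends to [0]. *)
Lemma gaussian_var : s ^+ 2 <= v.
Proof.
have v0 : 0 <= v.
  by rewrite -lee_fin (le_trans _ intX2)// integral_ge0// => w _; rewrite lee_fin sqr_ge0.
have [->|s0] := eqVneq s 0; first by rewrite expr0n.
have s20 : 0 < s ^+ 2 by rewrite exprn_even_gt0.
have key a : 0 < a -> s ^+ 2 <= v * (1 + 2 * a * s ^+ 2).
  move=> a0.
  have : ((\int[P]_w (expR (- (a * X w ^+ 2)))%:E) + (a * v)%:E >= 1)%E.
    apply: (@le_trans _ _ (\int[P]_w ((expR (- (a * X w ^+ 2)))%:E + (a * X w ^+ 2)%:E))%E).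
      rewrite -[leLHS](@probability_setT _ _ _ P) -[leLHS]mul1e -integral_cst//.
      apply: ge0_le_integral => //.
      - apply: emeasurable_funD; apply/measurable_EFinP.
          apply: measurableT_comp => //; apply: measurableT_comp => //.
          by apply: measurable_funM => //; exact: measurable_funX.
        by apply: measurable_funM => //; exact: measurable_funX.
      - move=> w _; rewrite -EFinD lee_fin.
        by have := expR_ge1Dx (- (a * X w ^+ 2)); lra.
    rewrite ge0_integralD//; last first.
    - apply/measurable_EFinP.
      by apply: measurable_funM => //; exact: measurable_funX.
    - by move=> w _; rewrite lee_fin mulr_ge0 ?sqr_ge0// ltW.
    - apply/measurable_EFinP.
      apply: measurableT_comp => //; apply: measurableT_comp => //.
      by apply: measurable_funM => //; exact: measurable_funX.
    apply: leeD2l; under eq_integral do rewrite EFinM.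
    rewrite ge0_integralZl//; last 2 first.
    - by move=> w _; rewrite lee_fin sqr_ge0.
    - by rewrite lee_fin ltW.
    by rewrite EFinM lee_pmul2l// lte_fin.
  rewrite (@gaussian_law_integral (fun x => expR (- (a * x ^+ 2)))); last 2 first.
  - by move=> x; exact: expR_ge0.
  - apply: measurableT_comp => //=; apply: measurableT_comp => //=.
    exact: measurable_funM.
  rewrite (negbTE s0) gaussian_mean normal_prob_expRNsqr// -EFinD lee_fin.
  set q := Num.sqrt _.
  have q21 : 1 < 1 + 2 * a * s ^+ 2 by have := mulr_gt0 a0 s20; lra.
  have q0 : 0 < q by rewrite sqrtr_gt0 (lt_trans _ q21).
  have qq : q ^+ 2 = 1 + 2 * a * s ^+ 2 by rewrite sqr_sqrtr// ltW// (lt_trans _ q21).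
  have q1 : 1 < q by rewrite -(ltr_pXn2r (_ : 0 < 2)%N) ?nnegrE ?ltW// expr1n qq.
  rewrite -qq -lerBlDl => h.
  have {}h : q - 1 <= a * v * q.
    by rewrite -(ler_pM2r q0) mulrBl mul1r mulVf ?gt_eqF in h.
  (* Then [2 a s^2 = (q - 1) (q + 1) <= a v q (q + 1) <= 2 a v q^2], since [q >= 1]. *)
  have e : 2 * a * s ^+ 2 = (q - 1) * (q + 1) by rewrite -subr_sqr expr1n qq; ring.
  rewrite -(ler_pM2l (_ : 0 < 2 * a)) ?mulr_gt0// e.
  apply: (@le_trans _ _ (a * v * q * (q + 1))); first by rewrite ler_pM2r// addr_gt0.
  have : 0 <= a * v * q by rewrite !mulr_ge0// ltW.
  by move: q1; nra.
rewrite leNgt; apply/negP => vs.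
have w0 : 0 < v * s ^+ 2.
  rewrite mulr_gt0// lt_neqAle v0 andbT; apply/eqP => v00.
  by have := key 1 ltr01; rewrite -v00 mul0r leNgt s20.
(* With this [a] the upper bound in [key] is the midpoint of [v] and [s^2], which is below [s^2]. *)
have /key : 0 < (s ^+ 2 - v) / (4 * (v * s ^+ 2)).
  by apply: divr_gt0; [rewrite subr_gt0 | exact: mulr_gt0].
have -> : v * (1 + 2 * ((s ^+ 2 - v) / (4 * (v * s ^+ 2))) * s ^+ 2) = (s ^+ 2 + v) / 2.
  have v1 : v != 0 by apply: contraTneq w0 => ->; rewrite mul0r ltxx.
  by field; rewrite s0 v1.
by lra.
Qed.

Lemma gaussian_tail (t a : R) : 0 <= t ->
  (P [set w | (a <= X w)%R] <= (expR (- (t * a) + t ^+ 2 * v / 2))%:E)%E.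
Proof.
move=> t0.
have mA : measurable [set w | a <= X w].
  rewrite (_ : [set w | _] = X @^-1` `[a, +oo[); last first.
    by apply/seteqP; split => w /=; rewrite in_itv/= andbT.
  by rewrite -[_ @^-1` _]setTI; exact: mX.
rewrite -[leLHS](_ : (\int[P]_w (\1_[set w | a <= X w] w)%:E = _)%E); last first.
  by rewrite integral_indic// setIT.
apply: (@le_trans _ _ (\int[P]_w ((expR (- (t * a)))%:E * (expR (t * X w))%:E))%E).
  apply: ge0_le_integral => //.
  - exact/measurable_EFinP.
  - under eq_fun do rewrite -EFinM.
    apply/measurable_EFinP; apply: measurable_funM => //.
    by apply: measurableT_comp => //; exact: measurable_funM.
  - move=> w _; rewrite -EFinM lee_fin -expRD indicE.
    case: (boolP (w \in _)) => [|_]; last by rewrite expR_ge0.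
    rewrite inE /= => aX; rewrite -[leLHS]expR0 ler_expR.
    by rewrite addrC subr_ge0 ler_wpM2l.
rewrite ge0_integralZl//; last first.
  apply/measurable_EFinP; apply: measurableT_comp => //.
  exact: measurable_funM.
rewrite gaussian_mgf gaussian_mean mulr0 add0r -EFinM -expRD lee_fin ler_expR lerD2l.
rewrite ler_pM2r// [leRHS]mulrC ler_wpM2r ?sqr_ge0//.
exact: gaussian_var.
Qed.

End gaussian.

(** * The union bound *)

Section dgff_tail.
Context {R : realType} dW (W : measurableType dW) (Px : Z2 -> probability W R).
Variable S : nat -> W -> Z2.
Hypothesis hS : is_srw Px S.

Lemma V_enum (N : nat) : exists2 s : seq Z2, uniq s & forall z, V N z <-> z \in s.
Proof.
pose pt (ij : 'I_(N.*2) * 'I_(N.*2)) : Z2 := (ij.1%:Z - N%:Z, ij.2%:Z - N%:Z).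
exists (undup [seq z <- [seq pt ij | ij : 'I_(N.*2) * 'I_(N.*2)] | `[< V N z >]]).
  exact: undup_uniq.
move=> z; rewrite mem_undup mem_filter; split => [Vz|/andP[/asboolP]//].
apply/andP; split; first exact/asboolP.
have [i [j ->]] := V_finite_range N z Vz.
by apply/mapP; exists (i, j) => //; rewrite mem_enum.
Qed.

(* The box is contained in a translate, centred at [y], of the box of twice
   the size. *)
Lemma green_diag_le (N : nat) (y : Z2) : (0 < N)%N -> V N y ->
  (green Px S (V N) y y <= (2 / pi * ln N%:R + 10)%:E)%E.
Proof.
move=> N0 Vy; have M0 : (0 < N.*2)%N by lia.
have [s us Vs] := V_enum N.
pose u (z : Z2) : R := box_green N.*2 (z.1 - y.1, z.2 - y.2).
have u0 z : 0 <= u z by exact: box_green_ge0.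
have usuper (a : Z2) : V N a -> (a == y)%:R + 4^-1 * (\sum_(b <- nbrs a) u b) <= u a.
  move=> Va; rewrite /u -[leRHS]box_green_laplacian//; last first.
    by move: Vy Va; case: (y) (a) => y1 y2 [a1 a2]; rewrite /V /=; lia.
  rewrite le_eqVlt; apply/orP; left; apply/eqP; congr (_ + _ * _).
    case: (y) (a) => y1 y2 [a1 a2].
    by rewrite !xpair_eqE /= !subr_eq0.
  rewrite !big_cons !big_nil /=.
  by congr (box_green _ (_, _) + (box_green _ (_, _) + (box_green _ (_, _) +
    (box_green _ (_, _) + _)))); lia.
apply: (le_trans (@green_le R _ W Px S hS (V N) s us Vs y u u0 usuper y)).
rewrite lee_fin /u !subrr (le_trans (box_green0_le _ M0))//.
have -> : (N.*2.*2)%:R = 4 * N%:R :> R by rewrite -!muln2 -mulnA mulnC natrM.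
have N0' : (0 : R) < N%:R by rewrite ltr0n.
(* The doubled box gives [ln (4 N)]; as [ln 4 <= 4] and [2 / pi <= 1], the constant becomes
   [6 + 4 = 10]. *)
rewrite lnM ?posrE// mulrDr.
have := @ln_sublinear R 4 ltac:(lra).
have : 0 <= ln 4 :> R by apply: ln_ge0; lra.
have : 0 <= 2 / (pi : R) <= 1.
  by rewrite divr_ge0 ?pi_ge0//= ler_pdivrMr ?pi_gt0//; have := @pi_ge2 R; lra.
by move: (2 / pi) => c /andP[c0 c1]; nra.
Qed.

Lemma dgff_tail (N : nat) d (T : measurableType d) (P : probability T R)
    (h : Z2 -> T -> R) (y : Z2) (t a : R) :
  (0 < N)%N -> is_dgff P Px S N h -> V N y -> 0 <= t ->
  (P [set w | (a <= h y w)%R] <=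
   (expR (- (t * a) + t ^+ 2 * (2 / pi * ln N%:R + 10) / 2))%:E)%E.
Proof.
move=> N0 [mh gh Eh covh] Vy t0.
(* The marginal [h y] is the linear combination with coefficients the Dirac mass at [y]. *)
have [_ [m [s lawh]]] := gh (fun z => (z == y)%:R).
have hE : (fun w => \sum_(x \in V N) (x == y)%:R * h x w) = h y.
  apply/funext => w; rewrite -(fsbig_widen [set y] (V N)).
  - by rewrite fsbig_set1 eqxx mul1r.
  - by move=> _ ->.
  - by move=> x [_ /= xy]; rewrite (introF eqP xy) mul0r.
rewrite hE in lawh.
apply: (@gaussian_tail _ _ _ P (h y) m s) => //; [exact: mh|exact: Eh|].
by rewrite covh// green_diag_le.
Qed.

End dgff_tail.

Section union_bound.
Context {R : realType}.

Definition square (x : Z2) (k : nat) : seq Z2 :=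
  [seq (x.1 - k%:Z + i%:Z, x.2 - k%:Z + j%:Z) | i <- iota 0 k.*2.+1, j <- iota 0 k.*2.+1].

Lemma mem_square (x y : Z2) k : (y \in square x k) = (sup_dist x y <= k%:Z).
Proof.
apply/idP/idP.
  move=> /allpairsP[[i j]]; rewrite !mem_iota /= => -[ik jk ->].
  by rewrite /sup_dist /= ge_max; lia.
rewrite /sup_dist ge_max => xy; apply/allpairsP.
exists (absz (y.1 - x.1 + k%:Z), absz (y.2 - x.2 + k%:Z)).
rewrite !mem_iota /=; split; [lia|lia|].
by move: xy; case: x y => x1 x2 [y1 y2] /= ?; congr (_, _); lia.
Qed.

Lemma size_square x k : size (square x k) = (k.*2.+1 ^ 2)%N.
Proof. by rewrite size_allpairs size_iota -mulnn. Qed.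

(** Distances are integers: if no point of [A] is within the integer part [k] of [rho], then
    [dist_to x A >= k + 1 > rho], also for empty [A]. *)
Lemma dist_to_le (x : Z2) (A : set Z2) (rho : R) : 0 <= rho ->
  (dist_to x A <= rho%:E)%E <-> exists2 y, y \in square x (Num.truncn rho) & A y.
Proof.
move=> rho0; have /andP[kr rk] := truncn_itv rho0.
split => [dxA|[y yk Ay]]; last first.
  apply: (@le_trans _ _ (sup_dist x y)%:~R%:E).
    by apply: ereal_inf_lbound; exists y.
  rewrite lee_fin (le_trans _ kr)// pmulrn ler_int -mem_square//.
apply: contrapT => nA; move: dxA; apply/negP; rewrite -ltNge.
apply: (@lt_le_trans _ _ (Num.truncn rho).+1%:R%:E); first by rewrite lte_fin.
apply: le_ereal_inf_tmp => _ [y Ay <-]; rewrite lee_fin pmulrn ler_int.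
rewrite leNgt; apply/negP => xy; apply: nA; exists y => //.
by rewrite mem_square; lia.
Qed.

End union_bound.

Section trap_probability.
Context {R : realType} dW (W : measurableType dW) (Px : Z2 -> probability W R).
Variable S : nat -> W -> Z2.
Hypothesis hS : is_srw Px S.
Variables (beta gamma delta : R).
Hypotheses (hbeta : 0 < beta) (hdelta : 0 < delta).

(** The exponents [A] and [B] of the one-site bound: [log_power] comes from the logarithmic factor
    of [t_hat], and [log_const] from the variance error [10] and from [delta]. *)
Definition log_power : R := 2 * ((3 + 2 * gamma) / (2 * alpha)) / Num.sqrt g.
Definition log_const : R := 20 / g - 2 * ln delta / (beta * Num.sqrt g).

Lemma g_gt0 : 0 < g :> R.
Proof. by rewrite /g divr_gt0 ?pi_gt0. Qed.

Variables (N : nat) (d : measure_display) (T : measurableType d).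
Variables (P : probability T R) (h : Z2 -> T -> R).
Hypotheses (N3 : (3 <= N)%N) (hh : is_dgff P Px S N h).

Let L : R := ln N%:R.

Let L_gt0 : 0 < L. Proof. by rewrite ln_gt0// ltr1n; lia. Qed.

Let trap_level : R := ln (delta * t_hat beta gamma N) / beta.

Let trapped_event y := [set w | trap_set beta gamma delta N (fun y => h y w) y].

Let t_hat_gt0 : 0 < t_hat beta gamma N.
Proof. by rewrite mulr_gt0// powR_gt0// ltr0n; lia. Qed.

Let trapped_eventE y : V N y -> trapped_event y = [set w | trap_level <= h y w].
Proof.
move=> Vy; apply/seteqP; rewrite /trapped_event /trap_set /tau_hat /tau /trap_level.
have e w : (delta <= expR (beta * h y w) / t_hat beta gamma N) =
    (ln (delta * t_hat beta gamma N) / beta <= h y w).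
  rewrite ler_pdivlMr// ler_pdivrMr// [h y w * _]mulrC.
  by rewrite -[RHS]ler_expR lnK// posrE mulr_gt0.
by split => w /=; rewrite e => // -[].
Qed.

Let measurable_trapped_event y : measurable (trapped_event y).
Proof.
have [Vy|Vy] := pselect (V N y); last first.
  rewrite (_ : trapped_event y = set0)//.
  by apply/seteqP; split => // w [].
case: hh => mh _ _ _; rewrite trapped_eventE//.
rewrite (_ : [set w | _] = h y @^-1` `[trap_level, +oo[); last first.
  by apply/seteqP; split => w /=; rewrite in_itv/= andbT.
by rewrite -[_ @^-1` _]setTI; exact: mh.
Qed.

(* Chernoff's bound with parameter [2 / sqrt g], which is optimal to leading
   order for a variance [g ln N] and a level [2 sqrt g ln N]. *)
Let trapped_event_le y :
  (P (trapped_event y) <= (expR (- (2 * L) + log_power * ln L + log_const))%:E)%E.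
Proof.
have [Vy|Vy] := pselect (V N y); last first.
  rewrite (_ : trapped_event y = set0); last by apply/seteqP; split => // w [].
  by rewrite measure0 lee_fin expR_ge0.
rewrite trapped_eventE//.
have q0 : 0 < Num.sqrt g :> R by rewrite sqrtr_gt0 g_gt0.
have N0 : (0 < N)%N by lia.
apply: (le_trans (@dgff_tail _ _ _ _ _ hS N _ _ P h y (2 / Num.sqrt g) trap_level N0 hh Vy _)).
  by rewrite divr_ge0// ltW.
rewrite lee_fin ler_expR le_eqVlt; apply/orP; left; apply/eqP.
rewrite /trap_level lnM ?posrE// /t_hat lnM ?posrE ?powR_gt0 ?ltr0n// !ln_powR -/L.
rewrite (_ : 2 / pi = g)// /log_power /log_const.
have : g = Num.sqrt g ^+ 2 :> R by rewrite sqr_sqrtr// ltW// g_gt0.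
move: (Num.sqrt g) q0 => q q0 ->.
move: ((3 + 2 * gamma) / (2 * alpha)) (ln delta) (ln L) => k ld lL.
by field; rewrite !gt_eqF.
Qed.

Lemma near_trap_set_le (x : Z2) (rho : R) : 0 <= rho ->
  (P [set w | (dist_to x (trap_set beta gamma delta N (fun y => h y w)) <= rho%:E)%E] <=
   ((2 * rho + 1) ^+ 2 * expR (- (2 * L) + log_power * ln L + log_const))%:E)%E.
Proof.
move=> rho0; set k := Num.truncn rho; set c := expR _.
(* The square may stick out of the box; its sites outside contribute empty events. *)
rewrite (_ : [set w | _] = \big[setU/set0]_(y <- square x k) trapped_event y); last first.
  rewrite -bigcup_seq; apply/seteqP; split => w /=.
    by move=> /(dist_to_le _ _ rho rho0)[y yk ty]; exists y.
  by move=> [y yk ty]; apply/(dist_to_le _ _ rho rho0); exists y.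
apply: (le_trans (@measure_bigsetU_seq_le _ _ _ P _ (square x k) _ measurable_trapped_event)).
apply: (@le_trans _ _ (\sum_(y <- square x k) c%:E)%E).
  by apply: lee_sum => y _; exact: trapped_event_le.
rewrite sumEFin lee_fin big_const_seq count_predT size_square iter_addr_0 -[leLHS]mulr_natl.
rewrite ler_wpM2r ?expR_ge0// natrX lerXn2r ?nnegrE// ?addr_ge0 ?mulr_ge0//.
have /andP[kr _] := truncn_itv rho0.
by rewrite -addn1 natrD -muln2 natrM mulrC lerD2r ler_wpM2l.
Qed.

End trap_probability.

(** * Comparison of [r_N] with powers of [ln N] *)

Section asymptotics.
Context {R : realType}.

Lemma expR_ge_sqr4 (z : R) : 0 <= z -> z ^+ 2 / 4 <= expR z.
Proof.
move=> z0; have e : expR z = expR (z / 2) ^+ 2.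
  by rewrite -expRM_natl; congr expR; field.
by rewrite e; have := expR_ge1Dx (z / 2); nra.
Qed.

Lemma log_scale_decay (p A z : R) : 2 <= p -> 1 <= z -> 2 * (A + 1) <= z ->
  (4 * expR (- (z `^ p)) + expR (- expR z)) ^+ 2 * expR (A * z) <= 25 * expR (- z).
Proof.
move=> p2 z1 zA; have z0 : 0 <= z by lra.
have zp : z ^+ 2 <= z `^ p by rewrite -powR_mulrn// ler_powR.
have e1 : expR (- (z `^ p)) <= expR (- (z ^+ 2 / 4)).
  by rewrite ler_expR; have := sqr_ge0 z; lra.
have e2 : expR (- expR z) <= expR (- (z ^+ 2 / 4)).
  by rewrite ler_expR lerN2 expR_ge_sqr4.
(* The remaining exponent is [- z^2 / 2 + A z], at most [- z] because [A + 1 <= z / 2]. *)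
apply: (@le_trans _ _ ((5 * expR (- (z ^+ 2 / 4))) ^+ 2 * expR (A * z))).
  rewrite ler_wpM2r ?expR_ge0// lerXn2r ?nnegrE ?addr_ge0 ?mulr_ge0 ?expR_ge0//.
  by lra.
rewrite exprMn -expRM_natl -mulrA -expRD.
have -> : 5 ^+ 2 = 25 :> R by ring.
by rewrite ler_wpM2l// ler_expR; nra.
Qed.

Lemma cvg_ln_nat : (fun N : nat => ln N%:R : R) @ \oo --> +oo.
Proof.
apply/cvgryPge => A; exists (Num.truncn (expR A)).+1 => // N /= AN.
rewrite -ler_expR lnK; last by rewrite posrE ltr0n; lia.
have /andP[_ /ltW/le_trans] := truncn_itv (expR_ge0 A); apply.
by rewrite ler_nat.
Qed.

End asymptotics.

Lemma near_trap_set_uniform_le (R : realType)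
    (dW : measure_display) (W : measurableType dW)
    (Px : Z2 -> probability W R) (S : nat -> W -> Z2) (hS : is_srw Px S)
    (beta gamma delta : R)
    (hbeta : 0 < beta) (hgamma : 0 < gamma) (hdelta : 0 < delta)
    (N : nat) (d : measure_display) (T : measurableType d)
    (P : probability T R) (h : Z2 -> T -> R) (x : Z2) :
  (3 <= N)%N -> is_dgff P Px S N h ->
  1 <= ln (ln N%:R) :> R -> 2 * (log_power gamma + 1) <= ln (ln N%:R) ->
  (P [set w | (dist_to x (trap_set beta gamma delta N (fun y => h y w))
           <= (2 * N%:R / r_ gamma N)%:E)%E] <=
   (25 * expR (log_const beta delta) * (ln N%:R)^-1)%:E)%E.
Proof.
move=> N3 hh z1 zA; set L := ln N%:R; set z := ln L in z1 zA.
have N0 : (0 : R) < N%:R by rewrite ltr0n; lia.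
have L0 : 0 < L by rewrite ln_gt0// ltr1n; lia.
have r0 : 0 < r_ gamma N by exact: expR_gt0.
have rho0 : 0 <= 2 * N%:R / r_ gamma N by rewrite divr_ge0 ?mulr_ge0// ltW.
apply: le_trans
  (@near_trap_set_le _ _ _ _ _ hS beta gamma delta hbeta hdelta N _ _ P h N3 hh x _ rho0) _.
rewrite lee_fin -/L -/z.
have decay := @log_scale_decay R (100 * (2 + gamma)) (log_power gamma) z ltac:(lra) z1 zA.
have ez : expR z = L by rewrite /z lnK.
have eL : expR L = N%:R by rewrite /L lnK.
have ezN : expR (- z) = L^-1 by rewrite expRN ez.
(* The factor [N^-2] of the one-site bound is moved into the square, turning [4 N / r_N + 1] into
   [4 / r_N + 1 / N]. *)
have e : (2 * (2 * N%:R / r_ gamma N) + 1) ^+ 2 *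
    expR (- (2 * L) + log_power gamma * z + log_const beta delta) =
  expR (log_const beta delta) * ((4 * expR (- (z `^ (100 * (2 + gamma)))) + expR (- expR z)) ^+ 2
    * expR (log_power gamma * z)).
  rewrite (expRD _ (log_const beta delta)) (expRD (- (2 * L))).
  rewrite (_ : - (2 * L) = 2 * - L); last by ring.
  rewrite expRM_natl !expRN ez eL -/(r_ gamma N).
  move: (expR (_ * z)) (expR (log_const _ _)) (r_ _ _) (N%:R) r0 N0 => a b r n r0' n0.
  by field; rewrite !gt_eqF.
rewrite e -ezN [leRHS](_ : _ = expR (log_const beta delta) * (25 * expR (- z))).
  by rewrite ler_wpM2l ?expR_ge0.
by rewrite mulrA [25 * _]mulrC.
Qed.

Theorem theorem1p7 (R : realType)
    (dW : measure_display) (W : measurableType dW)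
    (Px : Z2 -> probability W R) (S : nat -> W -> Z2)
    (hS : is_srw Px S)
    (d : nat -> measure_display) (T : forall N : nat, measurableType (d N))
    (P : forall N : nat, probability (T N) R)
    (h : forall N : nat, Z2 -> T N -> R)
    (hh : forall N : nat, (3 <= N)%N -> is_dgff (P N) Px S N (h N))
    (beta gamma delta : R)
    (hbeta : 0 < beta) (hgamma : 0 < gamma < 1) (hdelta : 0 < delta) :
  limn_esup (fun N : nat =>
    ereal_sup [set P N [set w |
        (dist_to x (trap_set beta gamma delta N (fun y => h N y w))
           <= (2 * N%:R / r_ gamma N)%:E)%E] | x in V N]) = 0%E.
Proof.
have /andP[gamma0 _] := hgamma.
set u := (X in limn_esup X).
have lnlnN K : \forall N \near \oo, K <= ln (ln N%:R) :> R.
  have /cvgryPge/(_ (expR K)) := @cvg_ln_nat R; apply: filterS => N KN.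
  by rewrite -ler_expR lnK// posrE (lt_le_trans _ KN)// expR_gt0.
suff ucvg : u @ \oo --> 0%E.
  rewrite is_cvg_limn_esupE; first exact/cvg_lim.
  by apply/cvg_ex; exists 0%E.
apply: (@squeeze_cvge _ _ _ _ (cst 0%E) _
  (fun N => (25 * expR (log_const beta delta) * (ln N%:R)^-1)%:E)); last 2 first.
- exact: cvg_cst.
- apply: cvg_EFin; first exact: nearW.
  rewrite -[X in _ --> X](mulr0 (25 * expR (log_const beta delta))).
  apply: cvgMl_tmp => /=; apply/gtr0_cvgV0; last exact: cvg_ln_nat.
  exists 2%N => // N /= N2; by rewrite ln_gt0// ltr1n.
near=> N.
have N3 : (3 <= N)%N by near: N; exists 3%N.
apply/andP; split.
  (* A supremum over the empty set would be [-oo]; the origin shows that the box is nonempty. *)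
  apply: le_ereal_sup_tmp; eexists; first by exists (0, 0) => //; rewrite /V /=; lia.
  exact: measure_ge0.
apply: ge_ereal_sup => _ [x _ <-].
apply: (@near_trap_set_uniform_le _ _ _ _ _ hS) => //; [exact: hh|near: N; exact: lnlnN..].
Unshelve. all: by end_near.
Qed.
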